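(* Let $R$ be a unital ring and let $M$ be a right $R$-module. Suppose that (1) $M$ is projective, (2) $M$ is a local module, and (3) $M$ is a $D_2$-module. Then $M$ is a $C$-$Rad$-$D_{11}$-module.
   Context: All rings are unital and all modules are right modules. $Rad(L)$ denotes the Jacobson radical of a module $L$ (the sum of all its small submodules). A module $M$ is local if it has a largest proper submodule, i.e. a proper submodule containing all proper submodules of $M$. A module $M$ is a $D_2$-module if whenever $A\le M$ is a submodule such that $M/A$ is isomorphic to a direct summand of $M$, then $A$ is a direct summand of $M$. For submodules $N,L$ of $M$, $L$ is a $Rad$-supplement of $N$ in $M$ if $N+L=M$ and $N\cap L\subseteq Rad(L)$. A module $M$ is a $Rad$-$D_{11}$-module if every submodule of $M$ has a $Rad$-supplement in $M$ that is a direct summand of $M$. A module $M$ is a $C$-$Rad$-$D_{11}$-module (completely-$Rad$-$D_{11}$-module) if every direct summand of $M$ is a $Rad$-$D_{11}$-module. *)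

(* Defs.v *)
From HB Require Import structures.
From mathcomp Require Import all_boot all_algebra.

Set Implicit Arguments.
Unset Strict Implicit.
Unset Printing Implicit Defensive.

Import GRing.Theory.
Local Open Scope ring_scope.
Local Open Scope quotient_scope.

(* A right R-module is a left module over the converse ring R^c: the right     *)
(* action x . a is written a *: x.  R is a pzRingType, so that the zero ring   *)
(* is a unital ring as well.                                                   *)
Notation rmodType R := (lmodType R^c).

(* Submodules are MathComp's submodClosed predicates.  They are bool-valued,   *)
(* and modules carry a choiceType structure: under excluded middle and choice  *)
(* neither is a restriction.                                                   *)

Section SubmoduleAsModule.
Variables (R : pzRingType) (M : lmodType R) (N : submodClosed M).

Definition submodule : Type := {x : M | x \in N}.

HB.instance Definition _ := SubChoice.on submodule.
HB.instance Definition _ := [SubChoice_isSubLmodule of submodule by <:].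

End SubmoduleAsModule.

Section QuotientModule.
Variables (R : pzRingType) (M : lmodType R) (N : submodClosed M).

(* Quotient.quot expects a zmodClosed predicate; a submodule is one because    *)
(* - x = (-1) *: x.                                                            *)
Definition submodule_pred : {pred M} := [in N].

Fact submodule_pred_closed : zmod_closed submodule_pred.
Proof.
by case: (submodClosedP N) => N0 NZ; split=> // x y Nx Ny;
  rewrite addrC -scaleN1r; apply: NZ.
Qed.

HB.instance Definition _ :=
  GRing.isZmodClosed.Build M submodule_pred submodule_pred_closed.

Definition quotient_module : Type := Quotient.quot submodule_pred.

HB.instance Definition _ := GRing.Zmodule.on quotient_module.

Definition quotient_proj (x : M) : quotient_module :=
  \pi_(Quotient.quot submodule_pred) x.

Definition quotient_repr (u : quotient_module) : M :=
  repr (u : Quotient.quot submodule_pred).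

Definition quotient_scale (a : R) (u : quotient_module) : quotient_module :=
  quotient_proj (a *: quotient_repr u).

Fact quotient_reprK : cancel quotient_repr quotient_proj.
Proof. exact: reprK. Qed.

Fact quotient_projP x y : quotient_proj x = quotient_proj y <-> x - y \in N.
Proof.
rewrite -[_ \in N]/(_ \in submodule_pred) Quotient.idealrBE.
by split=> [/eqP | /eqP].
Qed.

Fact quotient_projD : {morph quotient_proj : x y / x + y}.
Proof. by move=> x y; apply: (@pi_addr _ _ _ _ _ (Quotient.quot _)). Qed.

Fact quotient_projZ a x :
  quotient_scale a (quotient_proj x) = quotient_proj (a *: x).
Proof.
apply/quotient_projP; rewrite -scalerBr rpredZ //.
by apply/quotient_projP; rewrite quotient_reprK.
Qed.

Fact quotient_scaleA a b u :
  quotient_scale a (quotient_scale b u) = quotient_scale (a * b) u.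
Proof. by rewrite -[u]quotient_reprK !quotient_projZ scalerA. Qed.

Fact quotient_scale1 : left_id 1 quotient_scale.
Proof. by move=> u; rewrite -[u]quotient_reprK quotient_projZ scale1r. Qed.

Fact quotient_scaleDr : right_distributive quotient_scale +%R.
Proof.
move=> a u v; rewrite -[u]quotient_reprK -[v]quotient_reprK -quotient_projD.
by rewrite !quotient_projZ scalerDr quotient_projD.
Qed.

Fact quotient_scaleDl u : {morph quotient_scale^~ u : a b / a + b}.
Proof.
move=> a b; rewrite -[u]quotient_reprK !quotient_projZ.
by rewrite scalerDl quotient_projD.
Qed.

HB.instance Definition _ := GRing.Zmodule_isLmodule.Build R quotient_module
  quotient_scaleA quotient_scale1 quotient_scaleDr quotient_scaleDl.

End QuotientModule.

Section ModuleNotions.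
Variable R : pzRingType.

Definition isomorphic (L M : lmodType R) : Prop :=
  exists f : {linear L -> M}, bijective f.

Definition projective (P : lmodType R) : Prop :=
  forall (A B : lmodType R) (g : {linear A -> B}) (f : {linear P -> B}),
    (forall b, exists a, g a = b) ->
    exists h : {linear P -> A}, forall x, g (h x) = f x.

Section Submodules.
Variable M : lmodType R.
Implicit Types C D K L N X : submodClosed M.

Definition proper_submodule N : Prop := ~ (forall x, x \in N).

(* N + L = M *)
Definition sum_is_full N L : Prop :=
  forall x : M, exists y z, [/\ y \in N, z \in L & x = y + z].

Definition small_submodule K : Prop :=
  forall X, sum_is_full K X -> forall x, x \in X.

(* The elements of an arbitrary sum of submodules are the finite sums of       *)
(* elements of these submodules.                                               *)
Definition Rad (x : M) : Prop :=
  exists2 s : seq M,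
    {in s, forall y, exists2 K, small_submodule K & y \in K}
    & x = \sum_(y <- s) y.

Definition direct_summand D : Prop :=
  exists2 C, sum_is_full D C & forall x, x \in D -> x \in C -> x = 0.

End Submodules.

(* Rad L is computed in the module L, not in M.                                *)
Definition Rad_supplement (M : lmodType R) (L N : submodClosed M) : Prop :=
  sum_is_full N L /\ forall x : submodule L, val x \in N -> Rad x.

Definition local_module (M : lmodType R) : Prop :=
  exists2 N : submodClosed M, proper_submodule N &
    forall K : submodClosed M, proper_submodule K -> {subset K <= N}.

Definition D2_module (M : lmodType R) : Prop :=
  forall A : submodClosed M,
    (exists2 D : submodClosed M, direct_summand D &
      isomorphic (quotient_module A) (submodule D)) ->
    direct_summand A.

Definition Rad_D11_module (M : lmodType R) : Prop :=
  forall N : submodClosed M,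
    exists2 L : submodClosed M, direct_summand L & Rad_supplement L N.

Definition C_Rad_D11_module (M : lmodType R) : Prop :=
  forall D : submodClosed M, direct_summand D -> Rad_D11_module (submodule D).

End ModuleNotions.

(* Main.v *)
Require Import Defs.
From HB Require Import structures.
From mathcomp Require Import all_boot all_algebra.
From Stdlib Require Import Classical.

(** Call a module hollow when it is not the sum of two proper submodules.
    A local module is hollow, since two proper submodules both lie in the
    largest one, hence so does their sum (local_module_hollow).  If a hollow
    module is D (+) C, then D or C is the whole module, and in the second case
    D = 0; either way D is a homomorphic image of the module, so D is hollow as
    well (hollow_direct_summand).  It remains to see that a hollow module has
    the Rad-D11 property (hollow_Rad_D11_module).  The two trivial summands
    suffice: 0 is a Rad-supplement of the whole module, and the whole module is
    a Rad-supplement of each proper submodule, because in a hollow module every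
    proper submodule is small and therefore lies in the radical. *)

Set Implicit Arguments.
Unset Strict Implicit.
Unset Printing Implicit Defensive.

Import GRing.Theory.
Local Open Scope ring_scope.

Section SubmoduleConstructions.
Variables (R : pzRingType) (M P : lmodType R).

Definition zero_submodule : {pred M} := pred1 0.

Fact zero_submodule_closed : submod_closed zero_submodule.
Proof.
split=> [|a x y]; rewrite !inE // => /eqP -> /eqP ->.
by rewrite scaler0 addr0.
Qed.

HB.instance Definition _ :=
  GRing.isSubmodClosed.Build R M zero_submodule zero_submodule_closed.

Definition full_submodule : {pred M} := predT.

Fact full_submodule_closed : submod_closed full_submodule.
Proof. by []. Qed.

HB.instance Definition _ :=
  GRing.isSubmodClosed.Build R M full_submodule full_submodule_closed.

Definition preimage (f : {linear M -> P}) (N : submodClosed P) : {pred M} :=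
  [pred x | f x \in N].

Fact preimage_closed f N : submod_closed (preimage f N).
Proof.
split=> [|a x y]; rewrite !inE ?linear0 ?rpred0 // => Nx Ny.
by rewrite linearP rpredD ?rpredZ.
Qed.

HB.instance Definition _ f N :=
  GRing.isSubmodClosed.Build R M (preimage f N) (preimage_closed f N).

End SubmoduleConstructions.

Section Hollow.
Variable R : pzRingType.
Implicit Types M P : lmodType R.

(** The zero module is hollow in this sense, so that the notion passes to all
    homomorphic images. *)
Definition hollow M : Prop :=
  forall K X : submodClosed M, sum_is_full K X ->
    (forall x, x \in K) \/ (forall x, x \in X).

Lemma local_module_hollow M : local_module M -> hollow M.
Proof.
move=> [N0 N0proper N0max] K X KX.
case: (classic (forall x, x \in K)) => [|Kproper]; first by left.
case: (classic (forall x, x \in X)) => [|Xproper]; first by right.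
case: N0proper => x; have [y [z [Ky Xz ->]]] := KX x.
by rewrite rpredD ?(N0max K Kproper y Ky) ?(N0max X Xproper z Xz).
Qed.

(** Preimages under a surjection preserve both properness of a submodule and
    the fact that two submodules add up to everything. *)
Lemma hollow_image M P (f : {linear M -> P}) :
  (forall y, exists x, f x = y) -> hollow M -> hollow P.
Proof.
move=> fsurj hM K X KX.
have full_of_preimage (N : submodClosed P) :
    (forall x, x \in preimage f N) -> forall y, y \in N.
  by move=> fN y; have [x <-] := fsurj y; exact: fN.
have fKX : sum_is_full (preimage f K) (preimage f X).
  move=> x; have [k [z [Kk Xz fx]]] := KX (f x).
  have [k' fk'] := fsurj k.
  exists k', (x - k'); split; last by rewrite addrC subrK.
    by rewrite inE fk'.
  by rewrite inE linearB /= fx fk' addrC addKr.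
by case: (hM _ _ fKX) => ?; [left | right]; exact: full_of_preimage.
Qed.

Lemma full_submodule_retraction M (D : submodClosed M) :
  (forall x, x \in D) ->
  exists f : {linear M -> submodule D}, forall y, f (val y) = y.
Proof.
move=> Dfull; pose g (x : M) : submodule D := Sub x (Dfull x).
have glin : linear g by move=> a x y; apply: val_inj; rewrite linearP.
pose gL := GRing.isLinear.Build _ _ _ _ g glin.
pose f : {linear M -> submodule D} := HB.pack g gL.
by exists f => y; apply: val_inj.
Qed.

Lemma hollow_full_submodule M (D : submodClosed M) :
  (forall x, x \in D) -> hollow M -> hollow (submodule D).
Proof.
move=> /full_submodule_retraction[f fK]; apply: (@hollow_image _ _ f) => y.
by exists (val y).
Qed.

Lemma hollow_direct_summand M (D : submodClosed M) :
  direct_summand D -> hollow M -> hollow (submodule D).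
Proof.
move=> [C DC DIC] hM; have [Dfull | Cfull] := hM _ _ DC.
  exact: hollow_full_submodule.
move=> K X _; left=> x; suff -> : x = 0 by rewrite rpred0.
by apply: val_inj; rewrite linear0; apply: DIC (valP x) (Cfull _).
Qed.

Lemma hollow_proper_small M (K : submodClosed M) :
  hollow M -> proper_submodule K -> small_submodule K.
Proof. by move=> hM Kproper X /hM[/Kproper|]. Qed.

Lemma small_sub_Rad M (K : submodClosed M) x :
  small_submodule K -> x \in K -> Rad x.
Proof.
move=> Ksmall Kx; exists [:: x]; last by rewrite big_seq1.
by move=> y; rewrite inE => /eqP ->; exists K.
Qed.

Lemma zero_direct_summand M : direct_summand (@zero_submodule R M).
Proof.
exists (@full_submodule R M : submodClosed M) => [x | x]; last by rewrite inE => /eqP.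
by exists 0, x; rewrite add0r !inE.
Qed.

Lemma full_direct_summand M : direct_summand (@full_submodule R M).
Proof.
exists (@zero_submodule R M : submodClosed M) => [x | x _]; last by rewrite inE => /eqP.
by exists x, 0; rewrite addr0 !inE.
Qed.

Lemma hollow_Rad_D11_module M : hollow M -> Rad_D11_module M.
Proof.
move=> hM N; case: (classic (forall x, x \in N)) => [Nfull | Nproper].
  exists (@zero_submodule R M : submodClosed M); first exact: zero_direct_summand.
  split=> [x | x _]; first by exists x, 0; rewrite addr0 rpred0 Nfull.
  suff -> : x = 0 by exists [::]; rewrite ?big_nil.
  by apply: val_inj; rewrite linear0; apply/eqP: (valP x).
exists (@full_submodule R M : submodClosed M); first exact: full_direct_summand.
split=> [x | x Nx]; first by exists 0, x; rewrite add0r rpred0.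
pose L := submodule (@full_submodule R M).
(* The radical is that of the full submodule taken as a module of its own, so
   smallness is needed for the trace of N there. *)
apply: (@small_sub_Rad L (preimage (val : {linear L -> M}) N)) => //.
apply: hollow_proper_small; first exact: hollow_full_submodule.
by move=> LN; apply: Nproper => y; exact: (LN (Sub y isT)).
Qed.

End Hollow.

Theorem theorem2p4 (R : pzRingType) (M : rmodType R)
    (projM : projective M) (localM : local_module M) (D2M : D2_module M) :
  C_Rad_D11_module M.
Proof.
move=> D Dsummand; apply: hollow_Rad_D11_module.
by apply: hollow_direct_summand => //; exact: local_module_hollow.
Qed.
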